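(* Assume (A1) with $\Omega\supseteq B(x^*,\delta)$, (A2), (A3), and (A4) with exponent $r\in(0,1]$. Let $\{x_k\}$ be generated by LMMSS with $\alpha_k=1$ and $\lambda_k=\|J_k^TF_k\|^r$ for all $k$. Then there exists $\varepsilon>0$ such that, if $x_0\in B(x^*,\varepsilon)$, the sequence $\{\operatorname{dist}(x_k,X^* )\}$ converges to zero superlinearly and $\{x_k\}$ converges to a point of $X^*\cap B(x^*,\delta/2)$.
   Context: Let $F:\mathbb{R}^n\to\mathbb{R}^m$ be twice continuously differentiable with $m\ge n$, $J(x)$ its Jacobian, $\phi(x)=\tfrac12\|F(x)\|^2$, $\nabla\phi(x)=J(x)^TF(x)$. Norms are Euclidean/spectral. $X^*=\{x: J(x)^TF(x)=0\}\neq\emptyset$; $\operatorname{dist}(x,X^* )=\inf_{z\in X^*}\|x-z\|$. Fix $x^*\in X^*$; $B(x^*,\delta)$ is the closed ball. $L\in\mathbb{R}^{p\times n}$ has rank $p\le n$. LMMSS iteration: given $x_k$ and $\lambda_k>0$, with $F_k=F(x_k)$, $J_k=J(x_k)$, let $d_k$ solve $(J_k^TJ_k+\lambda_kL^TL)d_k=-J_k^TF_k$ and $x_{k+1}=x_k+\alpha_kd_k$. (A1) there are $\Omega$ and $\gamma>0$ with $\|J(x)v\|^2+\|Lv\|^2\ge\gamma\|v\|^2$ for $x\in\Omega$, all $v$. (A2) $\delta\in(0,1)$, $L_0>0$ with $\|J(x)-J(y)\|\le L_0\|x-y\|$ on $B(x^*,\delta)$. (A3) $\omega>0$ with $\omega\operatorname{dist}(x,X^*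 )\le\|J(x)^TF(x)\|$ on $B(x^*,\delta)$. (A4) $r\in(0,1]$, $C\ge0$ with $\|(J(x)-J(z))^TF(z)\|\le C\|x-z\|^{1+r}$ for $x\in B(x^*,\delta)$, $z\in X^*\cap B(x^*,\delta)$. *)

(* Defs.v *)
From HB Require Import structures.
From mathcomp Require Import all_boot all_order all_algebra.
From mathcomp Require Import all_classical all_reals all_analysis.
Set Implicit Arguments. Unset Strict Implicit. Unset Printing Implicit Defensive.
Import Order.TTheory GRing.Theory Num.Theory.
Import numFieldNormedType.Exports.
Local Open Scope classical_set_scope.
Local Open Scope ring_scope.

Definition enorm {R : realType} {n : nat} (v : 'cV[R]_n) : R :=
  Num.sqrt (\sum_(i < n) v i 0 ^+ 2).

Definition specnorm {R : realType} {m n : nat} (A : 'M[R]_(m, n)) : R :=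
  sup [set enorm (A *m v) | v in [set v : 'cV[R]_n | enorm v <= 1]].

Definition cball {R : realType} {n : nat} (c : 'cV[R]_n) (d : R) : set 'cV[R]_n :=
  [set x | enorm (x - c) <= d].

Definition setdist {R : realType} {n : nat} (x : 'cV[R]_n) (S : set 'cV[R]_n) : R :=
  inf [set enorm (x - z) | z in S].

Definition Xstar {R : realType} {m n : nat} (F : 'cV[R]_n -> 'cV[R]_m)
  (J : 'cV[R]_n -> 'M[R]_(m, n)) : set 'cV[R]_n :=
  [set x | (J x)^T *m F x = 0].

(* LMMSS iteration with alpha_k = 1 and lambda_k = ||J_k^T F_k||^r:
   d_k = x_{k+1} - x_k solves (J_k^T J_k + lambda_k L^T L) d_k = - J_k^T F_k;
   if J_k^T F_k = 0 the method has stopped (d_k = 0). *)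
Definition LMMSS_seq {R : realType} {m n p : nat} (F : 'cV[R]_n -> 'cV[R]_m)
  (J : 'cV[R]_n -> 'M[R]_(m, n)) (L : 'M[R]_(p, n)) (r : R)
  (x : nat -> 'cV[R]_n) : Prop :=
  forall k : nat,
    let g := (J (x k))^T *m F (x k) in
    let lam := powR (enorm g) r in
    let d := x k.+1 - x k in
    ((J (x k))^T *m J (x k) + lam *: (L^T *m L)) *m d = - g /\
    (g = 0 -> d = 0).

Definition superlinear_to0 {R : realType} (u : nat -> R) : Prop :=
  u @ \oo --> (0 : R) /\
  forall eta : R, 0 < eta -> \forall k \near \oo, u k.+1 <= eta * u k.

(* Main.v *)
Require Import Defs.
From HB Require Import structures.
From mathcomp Require Import all_boot all_order all_algebra.
From mathcomp Require Import all_classical all_reals all_analysis.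
From mathcomp Require Import ring lra.
Import Order.TTheory GRing.Theory Num.Theory.
Import numFieldNormedType.Exports.
Local Open Scope classical_set_scope.
Local Open Scope ring_scope.

(** Write [G x = J(x)^T F(x)], [rho x = dist (x, X^* )], and let [z] in [X^*] be
    such that [a = |x - z| <= 2 rho x].  A first order Taylor expansion of [F]
    and (A4) give [G x = O(a)], so that, with (A3), [lam = |G x|^r] is of exact
    order [a^r].  If [H = J^T J + lam L^T L], then [H (x + d - z) = O(a^(1+r))]
    while (A1) gives [H >= gamma lam], hence [|x + d - z| = O(a)] and
    [|d| = O(rho x)].  Expanding [G (x + d)] around [x], where (A4) controls the
    terms in which the nonsmall vector [F z] occurs, gives
    [G (x + d) = O(a^(1+r))], and (A3) turns this into
    [rho (x + d) = O(rho(x)^(1+r))].  From a small enough ball the distances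
    [rho (x_k)] then at least halve at each step, so the steps are summable, the
    iterates stay near [x^*], and they converge. *)

Set Implicit Arguments.
Unset Strict Implicit.

(** * Euclidean and spectral norms *)

(** The entry of a one by one matrix product, so that bilinearity and the adjoint rule are instances
    of matrix algebra. *)
Definition dot {R : realType} {n : nat} (u v : 'cV[R]_n) : R := (u^T *m v) 0 0.

Lemma dotE (R : realType) n (u v : 'cV[R]_n) : dot u v = \sum_i u i 0 * v i 0.
Proof. by rewrite /dot mxE; apply: eq_bigr => i _; rewrite mxE. Qed.

Lemma dotC (R : realType) n (u v : 'cV[R]_n) : dot u v = dot v u.
Proof. by rewrite !dotE; apply: eq_bigr => i _; rewrite mulrC. Qed.

Lemma dotDr (R : realType) n (u v w : 'cV[R]_n) : dot u (v + w) = dot u v + dot u w.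
Proof. by rewrite /dot mulmxDr mxE. Qed.

Lemma dotZr (R : realType) n (u v : 'cV[R]_n) a : dot u (a *: v) = a * dot u v.
Proof. by rewrite /dot -scalemxAr mxE. Qed.

Lemma dotNr (R : realType) n (u v : 'cV[R]_n) : dot u (- v) = - dot u v.
Proof. by rewrite -scaleN1r dotZr mulN1r. Qed.

Lemma dotBr (R : realType) n (u v w : 'cV[R]_n) : dot u (v - w) = dot u v - dot u w.
Proof. by rewrite dotDr dotNr. Qed.

Lemma dotDl (R : realType) n (u v w : 'cV[R]_n) : dot (v + w) u = dot v u + dot w u.
Proof. by rewrite !(dotC _ u) dotDr. Qed.

Lemma dotZl (R : realType) n (u v : 'cV[R]_n) a : dot (a *: v) u = a * dot v u.
Proof. by rewrite !(dotC _ u) dotZr. Qed.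

Lemma dot_trmx (R : realType) m n (A : 'M[R]_(m, n)) (u : 'cV[R]_m) (v : 'cV[R]_n) :
  dot (A^T *m u) v = dot u (A *m v).
Proof. by rewrite /dot trmx_mul trmxK mulmxA. Qed.

Section EuclideanNorm.
Variables (R : realType).
Implicit Types (m n : nat).

Lemma enorm_ge0 n (v : 'cV[R]_n) : 0 <= enorm v.
Proof. exact: sqrtr_ge0. Qed.
Hint Resolve enorm_ge0 : core.

Lemma enorm_sq n (v : 'cV[R]_n) : enorm v ^+ 2 = dot v v.
Proof.
rewrite dotE /enorm sqr_sqrtr; last by apply: sumr_ge0 => i _; exact: sqr_ge0.
by apply: eq_bigr => i _; rewrite expr2.
Qed.

Lemma normr_coord_le n (v : 'cV[R]_n) i : `|v i 0| <= enorm v.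
Proof.
rewrite -ler_sqr ?nnegrE// enorm_sq dotE real_normK ?num_real//.
rewrite (bigD1 i)//= -expr2 lerDl sumr_ge0// => j _.
by rewrite -expr2 sqr_ge0.
Qed.

Lemma enorm0 n : enorm (0 : 'cV[R]_n) = 0.
Proof.
by apply/eqP; rewrite -sqrf_eq0 enorm_sq dotE big1// => i _; rewrite mxE mul0r.
Qed.

Lemma enorm_eq0 n (v : 'cV[R]_n) : enorm v = 0 -> v = 0.
Proof.
move=> v0; apply/colP => i; rewrite mxE; apply/eqP.
by rewrite -normr_le0 -v0 normr_coord_le.
Qed.

Lemma enormZ n a (v : 'cV[R]_n) : enorm (a *: v) = `|a| * enorm v.
Proof.
apply/eqP; rewrite -(@eqrXn2 _ 2)// ?mulr_ge0// exprMn !enorm_sq.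
by rewrite dotZl dotZr real_normK ?num_real// mulrA expr2.
Qed.

Lemma enormN n (v : 'cV[R]_n) : enorm (- v) = enorm v.
Proof. by rewrite -scaleN1r enormZ normrN1 mul1r. Qed.

Lemma enorm_distC n (u v : 'cV[R]_n) : enorm (u - v) = enorm (v - u).
Proof. by rewrite -enormN opprB. Qed.

(** Cauchy-Schwarz: the squared norm of [enorm v *: u - enorm u *: v] equals
    [2 |u| |v| (|u| |v| - dot u v)], and the positive factor is divided out. *)
Lemma dot_le_enorm n (u v : 'cV[R]_n) : dot u v <= enorm u * enorm v.
Proof.
have [u0|u0] := eqVneq (enorm u) 0.
  by rewrite u0 (enorm_eq0 u0) mul0r dotE big1// => i _; rewrite mxE mul0r.
have [v0|v0] := eqVneq (enorm v) 0.
  by rewrite v0 (enorm_eq0 v0) mulr0 dotE big1// => i _; rewrite mxE mulr0.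
have uv : 0 < 2 * (enorm u * enorm v).
  by rewrite !mulr_gt0// lt_def ?u0 ?v0/=.
have := sqr_ge0 (enorm (enorm v *: u - enorm u *: v)).
rewrite enorm_sq -scaleN1r !(dotDl, dotDr, dotZl, dotZr) (dotC v u) -!enorm_sq.
move=> H; rewrite -subr_ge0 -(pmulr_rge0 _ uv); move: H.
by congr (_ <= _); ring.
Qed.

Lemma enorm_triangle n (u v : 'cV[R]_n) : enorm (u + v) <= enorm u + enorm v.
Proof.
rewrite -ler_sqr ?nnegrE ?addr_ge0// enorm_sq !(dotDl, dotDr) (dotC v u).
by rewrite -!enorm_sq; have := dot_le_enorm u v; lra.
Qed.

Lemma enorm_triangleB n (u v : 'cV[R]_n) : enorm (u - v) <= enorm u + enorm v.
Proof. by rewrite -(enormN v) enorm_triangle. Qed.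

Lemma enorm_dist_trans n (y x z : 'cV[R]_n) :
  enorm (x - z) <= enorm (x - y) + enorm (y - z).
Proof. by rewrite -[x - z](subrKA y) enorm_triangle. Qed.

Lemma enorm_le_sum n (v : 'cV[R]_n) : enorm v <= \sum_i `|v i 0|.
Proof.
rewrite -ler_sqr ?nnegrE ?sumr_ge0// enorm_sq dotE expr2 mulr_suml.
apply: ler_sum => i _; rewrite -expr2 -real_normK ?num_real// expr2.
rewrite ler_wpM2l// (bigD1 i)//= lerDl sumr_ge0//.
Qed.

(** A supremum is meaningful only for a bounded set; this makes [specnorm] a genuine least upper
    bound. *)
Lemma enorm_mulmx_bounded m n (A : 'M[R]_(m, n)) :
  has_ubound [set enorm (A *m v) | v in [set v : 'cV[R]_n | enorm v <= 1]].
Proof.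
exists (\sum_i \sum_j `|A i j|) => _ [v v1 <-].
apply: (le_trans (enorm_le_sum _)); apply: ler_sum => i _.
rewrite mxE; apply: (le_trans (ler_norm_sum _ _ _)); apply: ler_sum => j _.
by rewrite normrM ler_piMr// (le_trans _ v1)// normr_coord_le.
Qed.

Lemma enorm_mulmx_le m n (A : 'M[R]_(m, n)) (v : 'cV[R]_n) :
  enorm (A *m v) <= specnorm A * enorm v.
Proof.
have [v0|v0] := eqVneq (enorm v) 0.
  by rewrite v0 (enorm_eq0 v0) mulmx0 enorm0 mulr0.
have vp : 0 < enorm v by rewrite lt_def v0 /=.
rewrite -ler_pdivrMr//.
apply: (ub_le_sup (enorm_mulmx_bounded A)).
exists ((enorm v)^-1 *: v) => /=.
  by rewrite enormZ ger0_norm ?invr_ge0// mulVf.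
by rewrite -scalemxAr enormZ ger0_norm ?invr_ge0// mulrC.
Qed.

Lemma specnorm_ge0 m n (A : 'M[R]_(m, n)) : 0 <= specnorm A.
Proof.
apply: (ub_le_sup (enorm_mulmx_bounded A)).
by exists 0; rewrite /= ?mulmx0 enorm0 ?ler01.
Qed.

(** [|A^T w|^2 = dot w (A A^T w)], then Cauchy-Schwarz. [K] is any operator bound, so that [KJ] or
    [L0 * enorm d] can be used directly. *)
Lemma enorm_trmx_mulmx_le m n (A : 'M[R]_(m, n)) K : 0 <= K ->
  (forall v : 'cV[R]_n, enorm (A *m v) <= K * enorm v) ->
  forall w : 'cV[R]_m, enorm (A^T *m w) <= K * enorm w.
Proof.
move=> K0 AK w; have [w0|w0] := eqVneq (enorm (A^T *m w)) 0.
  by rewrite w0 mulr_ge0.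
have wp : 0 < enorm (A^T *m w) by rewrite lt_def w0 /=.
rewrite -(ler_pM2r wp) -expr2 enorm_sq dot_trmx.
apply: (le_trans (dot_le_enorm _ _)).
by rewrite (mulrC K) -mulrA ler_wpM2l.
Qed.

End EuclideanNorm.

(** * A first order Taylor estimate *)

Lemma dot_is_linear (R : realType) n (w : 'cV[R]_n) : linear (dot w : _ -> R^o).
Proof. by move=> a u v; rewrite dotDr dotZr. Qed.

HB.instance Definition _ (R : realType) n (w : 'cV[R]_n) :=
  GRing.isLinear.Build R 'cV[R]_n R^o _ (dot w) (dot_is_linear w).

(** A linear map is its own differential once it is continuous, which is checked coordinatewise. *)
Lemma is_diff_dot (R : realType) n (w y : 'cV[R]_n) :
  is_diff y (dot w : _ -> R^o) (dot w).
Proof.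
pose f : {linear 'cV[R]_n -> R^o} := dot w.
have cf : continuous f.
  rewrite (_ : f = (fun v => \sum_i w i 0 * v i 0) :> (_ -> _)); last first.
    by apply/funext => v; rewrite -dotE.
  apply: continuous_big => [|i _ v]; first exact: add_continuous.
  apply: (@cvgMl_tmp R _ (nbhs v) _ (fun u : 'cV[R]_n => u i 0)).
  exact: (@coord_continuous R n 1 i 0 v).
rewrite (_ : dot w = f)//; apply: DiffDef; first exact: linear_differentiable.
by rewrite diff_lin.
Qed.

Lemma cball_segment (R : realType) n (c x y : 'cV[R]_n) (d t : R) :
  0 <= t <= 1 -> cball c d x -> cball c d y -> cball c d (t *: (y - x) + x).
Proof.
rewrite /cball /= => /andP[t0 t1] cx cy.
have -> : t *: (y - x) + x - c = (1 - t) *: (x - c) + t *: (y - c).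
  by apply/colP => i; rewrite !mxE; ring.
apply: (le_trans (enorm_triangle _ _)); rewrite !enormZ !ger0_norm ?subr_ge0//.
have : (1 - t) * enorm (x - c) <= (1 - t) * d by rewrite ler_wpM2l ?subr_ge0.
have : t * enorm (y - c) <= t * d by rewrite ler_wpM2l.
lra.
Qed.

(** The mean value theorem is scalar, so it is applied to the component along the remainder [w]
    itself: [f 1 - f 0 = |w|^2] becomes [dot w ((J xi - J x) h)] with [xi] on the segment. Bounding
    the parameter of [xi] by 1 gives [K] instead of the sharp [K / 2]. *)
Lemma taylor1_le (R : realType) (n m : nat)
  (F : 'cV[R]_n -> 'cV[R]_m) (J : 'cV[R]_n -> 'M[R]_(m, n))
  (c : 'cV[R]_n) (d K : R) :
  (forall x, differentiable F x /\ forall v, 'd F x v = J x *m v) ->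
  (forall x y, cball c d x -> cball c d y ->
      specnorm (J x - J y) <= K * enorm (x - y)) -> 0 <= K ->
  forall x y, cball c d x -> cball c d y ->
    enorm (F y - F x - J x *m (y - x)) <= K * enorm (y - x) ^+ 2.
Proof.
move=> dF JK K0 x y cx cy; set h := y - x; set w := F y - F x - J x *m h.
pose f (t : R) : R := dot w (F (t *: h + x)) - t * dot w (J x *m h).
pose df (t : R) : R := dot w (J (t *: h + x) *m h) - dot w (J x *m h).
have fd (t : R) : is_derive t (1 : R) f (df t).
  have ga : is_diff t (fun t : R^o => t *: h + x) (fun t => t *: h).
    have := @is_diffD _ _ _ _ _ _ _ _ (is_diff_scalel t h) (is_diff_cst x t).
    by rewrite addr0.
  have Fd : is_diff (t *: h + x) F (fun v => J (t *: h + x) *m v).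
    by have [? H] := dF (t *: h + x); apply: DiffDef => //; apply/funext.
  have gd : is_diff t (fun t : R => dot w (F (t *: h + x)))
      (fun s => dot w (J (t *: h + x) *m (s *: h))).
    exact: (is_diff_comp (is_diff_comp ga Fd) (is_diff_dot _ _)).
  have ld : is_diff t (fun t : R => t * dot w (J x *m h))
      (fun s => s * dot w (J x *m h)).
    exact: is_diff_scalel.
  have fdiff : is_diff t f
      (fun s => dot w (J (t *: h + x) *m (s *: h)) - s * dot w (J x *m h)).
    exact: is_diffB gd ld.
  apply: DeriveDef; first exact/diff_derivable/ex_diff.
  by rewrite deriveE; [rewrite diff_val /df scale1r mul1r|exact: ex_diff].
have fc : {within `[0, 1], continuous f}.
  by apply: derivable_within_continuous => t _; exact: ex_derive.
have [s] := MVT ltr01 (fun t _ => fd t) fc.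
rewrite in_itv /= => /andP[s0 s1].
rewrite /f /df scale1r scale0r mul0r !subr0 mul1r mulr1 add0r /h subrK -/h.
move=> E.
have ww : enorm w ^+ 2 = dot w ((J (s *: h + x) - J x) *m h).
  by rewrite enorm_sq {2}/w !dotBr mulmxBl dotBr -E; ring.
have [w0|w0] := eqVneq (enorm w) 0.
  by rewrite w0 mulr_ge0// sqr_ge0.
have wp : 0 < enorm w by rewrite lt_def w0 enorm_ge0.
rewrite -(ler_pM2l wp) -expr2 ww; apply: (le_trans (dot_le_enorm _ _)).
rewrite ler_pM2l//; apply: (le_trans (enorm_mulmx_le _ _)).
rewrite expr2 mulrA ler_wpM2r ?enorm_ge0//.
apply: (le_trans (JK _ _ _ cx)); first by apply: cball_segment => //; rewrite !ltW.
by rewrite addrK enormZ ger0_norm ?(ltW s0)// ler_wpM2l// ler_piMl ?enorm_ge0// ltW.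
Qed.

(** * Distance to a set *)

Section SetDist.
Variables (R : realType) (n : nat).
Implicit Types (x y z : 'cV[R]_n) (S : set 'cV[R]_n).

Lemma setdist_ge0 x S : 0 <= setdist x S.
Proof.
(* The infimum of the empty set is 0 by default. *)
have [->|/set0P S0] := eqVneq S set0; first by rewrite /setdist image_set0 inf0.
apply: lb_le_inf; first by have [z Sz] := S0; exists (enorm (x - z)), z.
by move=> _ [z _ <-]; exact: enorm_ge0.
Qed.

Lemma setdist_le x z S : S z -> setdist x S <= enorm (x - z).
Proof.
move=> Sz; apply: ge_inf; last by exists z.
by exists 0 => _ [y _ <-]; exact: enorm_ge0.
Qed.

(** Near-minimisers stand in for projections onto [S]. *)
Lemma setdist_adherent x S e : S !=set0 -> 0 < e ->
  exists2 z, S z & enorm (x - z) < setdist x S + e.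
Proof.
move=> [z0 Sz0] e0; have hi : has_inf [set enorm (x - z) | z in S].
  split; first by exists (enorm (x - z0)), z0.
  by exists 0 => _ [y _ <-]; exact: enorm_ge0.
by have [_ [z Sz <-] ze] := inf_adherent e0 hi; exists z.
Qed.

Lemma setdist_triangle x y S : S !=set0 ->
  setdist x S <= enorm (x - y) + setdist y S.
Proof.
move=> S0; apply/ler_addgt0Pr => e e0.
have [z Sz ze] := setdist_adherent y S0 e0.
apply: (le_trans (setdist_le x Sz)).
by apply: (le_trans (enorm_dist_trans y _ _)); lra.
Qed.

End SetDist.

(** * One step of the method *)

Lemma trmxB (R : pzRingType) m n (A B : 'M[R]_(m, n)) : (A - B)^T = A^T - B^T.
Proof. exact: linearB. Qed.

Lemma powR_1D (R : realType) (a s : R) : 0 <= a -> 0 < s ->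
  powR a (1 + s) = a * powR a s.
Proof.
move=> a0 s0; rewrite powRD ?powRr1//.
by rewrite (_ : 1 + s == 0 = false)// gt_eqF// addr_gt0.
Qed.

Section LMMSSStep.
Variables (R : realType) (n m p : nat).
Variables (F : 'cV[R]_n -> 'cV[R]_m) (J : 'cV[R]_n -> 'M[R]_(m, n)).
Variables (L : 'M[R]_(p, n)) (xs : 'cV[R]_n) (gamma delta L0 omega r C : R).
Hypothesis dF : forall x, differentiable F x /\ forall v, 'd F x v = J x *m v.
Hypothesis Xxs : Xstar F J xs.
Hypothesis gamma0 : 0 < gamma.
Hypothesis A1 : forall x, cball xs delta x -> forall v : 'cV[R]_n,
  enorm (J x *m v) ^+ 2 + enorm (L *m v) ^+ 2 >= gamma * enorm v ^+ 2.
Hypothesis delta01 : 0 < delta < 1.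
Hypothesis L00 : 0 < L0.
Hypothesis A2 : forall x y, cball xs delta x -> cball xs delta y ->
  specnorm (J x - J y) <= L0 * enorm (x - y).
Hypothesis omega0 : 0 < omega.
Hypothesis A3 : forall x, cball xs delta x ->
  omega * setdist x (Xstar F J) <= enorm ((J x)^T *m F x).
Hypothesis r01 : 0 < r <= 1.
Hypothesis C0 : 0 <= C.
Hypothesis A4 : forall x z,
  cball xs delta x -> Xstar F J z -> cball xs delta z ->
  enorm ((J x - J z)^T *m F z) <= C * powR (enorm (x - z)) (1 + r).

Local Notation S := (Xstar F J).
Local Notation G x := ((J x)^T *m F x).
Local Notation ball := (cball xs delta).

(** On the ball, of radius below 1, [KJ] bounds the Jacobian and [KF] is a Lipschitz constant of
    [F], the 2 bounding the diameter. [M] is the linear growth rate of [G] away from [S]. *)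
Let KJ : R := specnorm (J xs) + L0.
Let KF : R := KJ + 2 * L0.
Let KL : R := specnorm L.
Let M : R := KJ * KF + C.

Let delta_gt0 : 0 < delta. Proof. by case/andP: delta01. Qed.
Let delta_lt1 : delta < 1. Proof. by case/andP: delta01. Qed.
Let r_gt0 : 0 < r. Proof. by case/andP: r01. Qed.
Let r_ge0 : 0 <= r. Proof. exact: ltW. Qed.
Let r1_ge0 : 0 <= 1 + r. Proof. by rewrite addr_ge0. Qed.
Let omega_ge0 : 0 <= omega. Proof. exact: ltW. Qed.
Let r_le1 : r <= 1. Proof. by case/andP: r01. Qed.
Let L0_ge0 : 0 <= L0. Proof. exact: ltW. Qed.
Let KJ_gt0 : 0 < KJ. Proof. by rewrite ltr_wpDl// specnorm_ge0. Qed.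
Let KJ_ge0 : 0 <= KJ. Proof. exact: ltW. Qed.
Let KF_gt0 : 0 < KF. Proof. by rewrite addr_gt0// mulr_gt0. Qed.
Let KF_ge0 : 0 <= KF. Proof. exact: ltW. Qed.
Let KL_ge0 : 0 <= KL. Proof. exact: specnorm_ge0. Qed.
Let M_gt0 : 0 < M. Proof. by rewrite ltr_pwDl// mulr_gt0. Qed.
Let M_ge0 : 0 <= M. Proof. exact: ltW. Qed.
Let ball_xs : ball xs. Proof. by rewrite /cball /= subrr enorm0 ltW. Qed.

Let ball_dist2 x y : ball x -> ball y -> enorm (x - y) <= 2.
Proof.
rewrite /cball /= => bx bY; apply: (le_trans (enorm_dist_trans xs _ _)).
by rewrite (enorm_distC xs); have := delta_lt1; lra.
Qed.

Let powR_le_id a : 0 <= a <= 1 -> powR a (1 + r) <= a.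
Proof.
case/andP; rewrite le_eqVlt => /predU1P[<- _|a0 a1].
  by rewrite powR0// gt_eqF// addr_gt0.
by apply: ge1r_powR; rewrite ?a0 ?a1// lerDl ltW.
Qed.

(** Here [r <= 1] enters: quadratic Taylor errors are absorbed into the order [1 + r]. *)
Let sqr_le_powR a : 0 <= a <= 1 -> a ^+ 2 <= powR a (1 + r).
Proof.
case/andP; rewrite le_eqVlt => /predU1P[<- _|a0 a1].
  by rewrite expr0n/= powR_ge0.
rewrite -powR_mulrn ?(ltW a0)//; apply: ger_powR; first by rewrite a0 a1.
by have := r_le1; lra.
Qed.

(** * Bounds on [J], [F] and [G] in the ball around [xs] *)

Lemma jacobian_bounded x v : ball x -> enorm (J x *m v) <= KJ * enorm v.
Proof.
move=> bx; rewrite -[J x](subrK (J xs)) mulmxDl.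
apply: (le_trans (enorm_triangle _ _)); rewrite addrC mulrDl lerD//.
  exact: enorm_mulmx_le.
apply: (le_trans (enorm_mulmx_le _ _)); rewrite ler_wpM2r ?enorm_ge0//.
apply: (le_trans (A2 bx ball_xs)); rewrite ler_piMr//.
by apply: le_trans bx _; exact: ltW.
Qed.

Lemma jacobian_trmx_bounded x w : ball x -> enorm ((J x)^T *m w) <= KJ * enorm w.
Proof.
by move=> bx; apply: enorm_trmx_mulmx_le => // v; exact: jacobian_bounded.
Qed.

Lemma residual_lipschitz x y : ball x -> ball y ->
  enorm (F y - F x) <= KF * enorm (y - x).
Proof.
move=> bx bY; rewrite -[F y - F x](subrK (J x *m (y - x))).
apply: (le_trans (enorm_triangle _ _)); rewrite addrC /KF mulrDl lerD//.
  exact: jacobian_bounded.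
apply: (le_trans (taylor1_le dF A2 L0_ge0 bx bY)).
rewrite (mulrC 2) -mulrA ler_wpM2l// expr2 ler_wpM2r ?enorm_ge0//.
exact: ball_dist2.
Qed.

(** As [G z = 0], [G x] splits into a term in [F x - F z], which is Lipschitz, and a term in [F z],
    which (A4) bounds. *)
Lemma gradient_le x z : ball x -> S z -> ball z -> enorm (x - z) <= 1 ->
  enorm (G x) <= M * enorm (x - z).
Proof.
move=> bx Sz bz xz1.
have -> : G x = (J x)^T *m (F x - F z) + (J x - J z)^T *m F z.
  rewrite trmxB mulmxBl mulmxBr (_ : G z = 0)//.
  by rewrite subr0 subrK.
apply: (le_trans (enorm_triangle _ _)); rewrite mulrDl lerD//.
  apply: (le_trans (jacobian_trmx_bounded _ bx)).
  by rewrite -mulrA ler_wpM2l// residual_lipschitz.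
apply: (le_trans (A4 bx Sz bz)); rewrite ler_wpM2l//.
by apply: powR_le_id; rewrite enorm_ge0.
Qed.

(** Points of [S] arbitrarily close to [x] make [G x] arbitrarily small. The half radius keeps these
    points in the ball. *)
Lemma setdist0_gradient x : cball xs (delta / 2) x -> setdist x S = 0 -> G x = 0.
Proof.
move=> bx dx; apply: enorm_eq0; apply/eqP; rewrite eq_le enorm_ge0 andbT.
apply/ler_addgt0Pr => e e0; rewrite add0r.
have S0 : S !=set0 by exists xs.
pose e' := Num.min (delta / 2) (e / M).
have e'0 : 0 < e' by rewrite lt_min !divr_gt0.
have [z Sz] := setdist_adherent x S0 e'0.
rewrite dx add0r lt_min => /andP[xz1 xz2].
have bx' : ball x by apply: (le_trans bx); have := delta_gt0; lra.
have bz : ball z.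
  rewrite /cball /=; apply: (le_trans (enorm_dist_trans x _ _)).
  move: bx xz1; rewrite /cball /= (enorm_distC z x); lra.
apply: (le_trans (gradient_le bx' Sz bz _)).
  by have := delta_lt1; have := delta_gt0; lra.
by rewrite mulrC -ler_pdivlMr// ltW.
Qed.

(** Tested against [v], the matrix gives [|J v|^2 + lam |L v|^2], which is at least [lam] times the
    quantity in (A1) because [lam <= 1]; Cauchy-Schwarz concludes. *)
Lemma lm_matrix_coercive x lam v : ball x -> 0 <= lam <= 1 ->
  gamma * lam * enorm v <= enorm (((J x)^T *m J x + lam *: (L^T *m L)) *m v).
Proof.
move=> bx /andP[l0 l1].
have [v0|v0] := eqVneq (enorm v) 0; first by rewrite v0 mulr0 enorm_ge0.
have vp : 0 < enorm v by rewrite lt_def v0 enorm_ge0.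
rewrite -(ler_pM2l vp); apply: le_trans (dot_le_enorm _ _).
rewrite (_ : _ * _ = lam * (gamma * enorm v ^+ 2)); last by ring.
rewrite mulmxDl -scalemxAl -!mulmxA dotDr dotZr !(dotC v) !dot_trmx -!enorm_sq.
have := ler_wpM2l l0 (A1 bx v); rewrite mulrDr => /le_trans; apply.
by rewrite lerD2r ler_piMl// sqr_ge0.
Qed.

(** [lb] and [Mr] are the constants in [lb a^r <= lam <= Mr a^r]; [omega / 2] combines (A3) with
    [a <= 2 dist]. [C1] sums the three error bounds in [lm_step_near], and [C2] divides by the
    coercivity constant. *)
Let lb : R := powR (omega / 2) r.
Let lb_gt0 : 0 < lb. Proof. by rewrite powR_gt0// divr_gt0. Qed.
Let Mr : R := powR M r.
Let Mr_ge0 : 0 <= Mr. Proof. exact: powR_ge0. Qed.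
Let C1 : R := C + KJ * L0 + Mr * KL ^+ 2.
Let C1_ge0 : 0 <= C1. Proof. by rewrite !addr_ge0 ?mulr_ge0 ?sqr_ge0. Qed.
Let C2 : R := C1 / (gamma * lb).
Let C2_ge0 : 0 <= C2. Proof. by rewrite divr_ge0// ltW// mulr_gt0. Qed.
(** The summands bound, in this order, the five terms of the splitting in [lm_step_gradient]. *)
Let C3 : R := KJ * L0 * (C2 + 1) ^+ 2 + Mr * KL ^+ 2 * (C2 + 1) +
  C * powR C2 (1 + r) + C + L0 * (C2 + 1) * KF * C2.

(** * One step from [x], measured against a near-projection [z] of [x] onto [S] *)

Section OneStep.
Variables (x z d : 'cV[R]_n).
Hypothesis bx : ball x.
Hypothesis Sz : S z.
Hypothesis bz : ball z.
Local Notation a := (enorm (x - z)).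
Hypothesis a_gt0 : 0 < a.
Hypothesis a1 : a <= 1.
Hypothesis a_dist : a <= 2 * setdist x S.
Hypothesis Ma1 : M * a <= 1.
Local Notation lam := (powR (enorm (G x)) r).
Hypothesis step : ((J x)^T *m J x + lam *: (L^T *m L)) *m d = - G x.

Let a_ge0 : 0 <= a. Proof. exact: enorm_ge0. Qed.
Let P : R := powR a (1 + r).
Let P_ge0 : 0 <= P. Proof. exact: powR_ge0. Qed.

Let aa_le : a ^+ 2 <= P. Proof. by apply: sqr_le_powR; rewrite a_ge0. Qed.

Let lam_le : lam <= Mr * powR a r.
Proof.
rewrite /Mr -powRM//; apply: ge0_ler_powR; rewrite ?nnegrE ?enorm_ge0 ?mulr_ge0//.
exact: gradient_le.
Qed.

Let lama_le : lam * a <= Mr * P.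
Proof. by rewrite /P powR_1D// (mulrC a) mulrA ler_wpM2r. Qed.

(** [lam <= (M a)^r]; the bound by 1 is what coercivity asks for. *)
Let lam_le1 : lam <= 1.
Proof.
apply: (le_trans lam_le); rewrite /Mr -powRM//.
rewrite [leRHS](_ : 1 = powR 1 r); last by rewrite powR1.
apply: ge0_ler_powR; rewrite ?nnegrE ?mulr_ge0//.
Qed.

Let lam_ge : lb * powR a r <= lam.
Proof.
rewrite /lb -powRM ?divr_ge0//; apply: ge0_ler_powR;
  rewrite ?nnegrE ?enorm_ge0 ?mulr_ge0 ?divr_ge0//.
apply: le_trans (A3 bx); rewrite -mulrA ler_wpM2l//.
by rewrite ler_pdivrMl.
Qed.

Let LTL_le v : enorm (L^T *m (L *m v)) <= KL ^+ 2 * enorm v.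
Proof.
apply: le_trans (enorm_trmx_mulmx_le KL_ge0 (enorm_mulmx_le L) _) _.
by rewrite expr2 -mulrA ler_wpM2l// enorm_mulmx_le.
Qed.

(* [H (d - (z - x))] is minus the sum of three terms of order [a ^ (1 + r)],
   while [H] is bounded below by a multiple of [lam], itself of order [a ^ r]. *)
Lemma lm_step_near : enorm (x + d - z) <= C2 * a.
Proof.
have arp : 0 < powR a r by rewrite powR_gt0.
set v := x + d - z; pose u := z - x; pose Rm := F z - F x - J x *m u.
pose H := (J x)^T *m J x + lam *: (L^T *m L).
have Hd : H *m d = - G x := step.
(* Since [G z = 0], the nonsmall [F z] is left only inside [Rm] and in the product that (A4)
   controls. *)
have Hv : H *m v = (J x)^T *m Rm - (lam *: (L^T *m (L *m u)) + (J x - J z)^T *m F z).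
  have -> : v = d - u by apply/colP => i; rewrite !mxE; ring.
  rewrite mulmxBr Hd /Rm !mulmxBr mulmxA trmxB mulmxBl (_ : G z = 0)//.
  rewrite /H !mulmxDl -!scalemxAl -!mulmxA subr0.
  by apply/colP => i; rewrite !mxE; ring.
have Hle : enorm (H *m v) <= C1 * P.
  rewrite Hv; apply: (le_trans (enorm_triangleB _ _)).
  have h1 : enorm ((J x)^T *m Rm) <= KJ * L0 * P.
    apply: (le_trans (jacobian_trmx_bounded _ bx)); rewrite -mulrA ler_wpM2l//.
    apply: (le_trans (taylor1_le dF A2 L0_ge0 bx bz)).
    by rewrite enorm_distC ler_wpM2l.
  have h2 : enorm (lam *: (L^T *m (L *m u))) <= Mr * KL ^+ 2 * P.
    rewrite enormZ ger0_norm ?powR_ge0//.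
    apply: (le_trans (ler_wpM2l (powR_ge0 _ _) (LTL_le _))).
    rewrite /u enorm_distC; have := ler_wpM2l (sqr_ge0 KL) lama_le.
    by congr (_ <= _); ring.
  have h3 := A4 bx Sz bz; rewrite -/P in h3.
  have := enorm_triangle (lam *: (L^T *m (L *m u))) ((J x - J z)^T *m F z).
  by rewrite /C1; lra.
have := lm_matrix_coercive (lam := lam) v bx.
rewrite powR_ge0 lam_le1 => /(_ isT) /le_trans/(_ Hle).
move=> Hc; rewrite /C2 mulrAC ler_pdivlMr ?mulr_gt0//.
(* Multiplying the goal by [a^r] matches [lam >= lb a^r] on the left and [P = a a^r] on the
   right. *)
rewrite -(ler_pM2r arp) -(mulrA C1) -powR_1D// -/P.
apply: le_trans Hc.
have := ler_wpM2l (mulr_ge0 (ltW gamma0) (enorm_ge0 v)) lam_ge.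
by congr (_ <= _); ring.
Qed.

Lemma lm_step_le : enorm d <= (C2 + 1) * a.
Proof.
have -> : d = (x + d - z) + (z - x) by apply/colP => i; rewrite !mxE; ring.
apply: (le_trans (enorm_triangle _ _)).
by rewrite mulrDl mul1r (enorm_distC z) lerD// lm_step_near.
Qed.

Hypothesis bxd : ball (x + d).

(** The step equation turns [J(x)^T (F x + J d)] into [- lam L^T L d]. What remains is
    [(J (x + d) - J x)^T F (x + d)]: its [F z] part is routed through [J z] to give two (A4) terms,
    and the rest is a product of two factors of order [a]. *)
Lemma lm_step_gradient : enorm (G (x + d)) <= C3 * P.
Proof.
pose Rm := F (x + d) - F x - J x *m d.
have E : G (x + d) = (J x)^T *m Rm - lam *: (L^T *m (L *m d)) +
    (J (x + d) - J z)^T *m F z - (J x - J z)^T *m F z +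
    (J (x + d) - J x)^T *m (F (x + d) - F z).
  have -> : lam *: (L^T *m (L *m d)) = - ((J x)^T *m (F x + J x *m d)).
    have := step; rewrite !mulmxDl -!scalemxAl -!mulmxA => st.
    by rewrite mulmxDr opprD -st addrAC subrr add0r.
  rewrite /Rm !trmxB !mulmxBl !mulmxBr mulmxDr.
  by apply/colP => i; rewrite !mxE; ring.
have dl := lm_step_le; have nl := lm_step_near.
have h1 : enorm ((J x)^T *m Rm) <= KJ * L0 * (C2 + 1) ^+ 2 * P.
  rewrite [leRHS](_ : _ = KJ * (L0 * ((C2 + 1) ^+ 2 * P))); last by ring.
  apply: (le_trans (jacobian_trmx_bounded _ bx)); rewrite ler_wpM2l//.
  have := taylor1_le dF A2 L0_ge0 bx bxd.
  rewrite (addrC x d) addrK /Rm (addrC x d) => /le_trans; apply; rewrite ler_wpM2l//.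
  have : enorm d ^+ 2 <= ((C2 + 1) * a) ^+ 2.
    by rewrite ler_sqr ?nnegrE ?enorm_ge0 ?mulr_ge0 ?addr_ge0.
  by move=> /le_trans; apply; rewrite exprMn ler_wpM2l ?sqr_ge0.
have h2 : enorm (lam *: (L^T *m (L *m d))) <= Mr * KL ^+ 2 * (C2 + 1) * P.
  rewrite enormZ ger0_norm ?powR_ge0//.
  apply: (le_trans (ler_wpM2l (powR_ge0 _ _) (LTL_le _))).
  apply: (@le_trans _ _ (lam * (KL ^+ 2 * ((C2 + 1) * a)))).
    by rewrite ler_wpM2l ?powR_ge0// ler_wpM2l ?sqr_ge0.
  have : KL ^+ 2 * (C2 + 1) * (lam * a) <= KL ^+ 2 * (C2 + 1) * (Mr * P).
    by rewrite ler_wpM2l// mulr_ge0 ?sqr_ge0// addr_ge0.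
  by congr (_ <= _); ring.
have h3 : enorm ((J (x + d) - J z)^T *m F z) <= C * powR C2 (1 + r) * P.
  apply: (le_trans (A4 bxd Sz bz)); rewrite -mulrA ler_wpM2l// /P -powRM//.
  apply: ge0_ler_powR; rewrite ?nnegrE ?enorm_ge0 ?(mulr_ge0 C2_ge0 a_ge0)//.
have h4 : enorm ((J x - J z)^T *m F z) <= C * P := A4 bx Sz bz.
have h5 : enorm ((J (x + d) - J x)^T *m (F (x + d) - F z)) <=
    L0 * (C2 + 1) * KF * C2 * P.
  have Jl v : enorm ((J (x + d) - J x) *m v) <= L0 * enorm d * enorm v.
    apply: (le_trans (enorm_mulmx_le _ _)); rewrite ler_wpM2r ?enorm_ge0//.
    by have := A2 bxd bx; rewrite (addrC x) addrK.
  apply: (le_trans (enorm_trmx_mulmx_le _ Jl _)).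
    by rewrite mulr_ge0 ?enorm_ge0.
  have Fl : enorm (F (x + d) - F z) <= KF * (C2 * a).
    by apply: (le_trans (residual_lipschitz bz bxd)); rewrite ler_wpM2l.
  have : L0 * enorm d * enorm (F (x + d) - F z) <=
         L0 * ((C2 + 1) * a) * (KF * (C2 * a)).
    by apply: ler_pM => //; rewrite ?mulr_ge0 ?enorm_ge0// ler_wpM2l.
  move=> /le_trans; apply.
  have : L0 * (C2 + 1) * KF * C2 * a ^+ 2 <= L0 * (C2 + 1) * KF * C2 * P.
    by rewrite ler_wpM2l// (mulr_ge0 (mulr_ge0 (mulr_ge0 _ _) _) _)// addr_ge0.
  by congr (_ <= _); ring.
rewrite E; apply: (le_trans (enorm_triangle _ _)).
rewrite [C3 * P]mulrDl lerD//; apply: (le_trans (enorm_triangleB _ _)).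
rewrite [leRHS]mulrDl lerD//; apply: (le_trans (enorm_triangle _ _)).
rewrite [leRHS]mulrDl lerD//; apply: (le_trans (enorm_triangleB _ _)).
by rewrite [leRHS]mulrDl lerD.
Qed.

End OneStep.

(** * The one-step estimate in terms of the distance to [S] alone *)

Definition lmmss_step (x x' : 'cV[R]_n) : Prop :=
  let g := G x in
  let d := x' - x in
  ((J x)^T *m J x + powR (enorm g) r *: (L^T *m L)) *m d = - g /\
  (g = 0 -> d = 0).

Lemma lmmss_step_superlinear : exists eta c3 c4 : R,
  [/\ 0 < eta, 0 < c3, 0 < c4 & forall x x', cball xs (delta / 2) x ->
    setdist x S <= eta -> lmmss_step x x' ->
    enorm (x' - x) <= c3 * setdist x S /\
    setdist x' S <= c4 * powR (setdist x S) (1 + r)].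
Proof.
have S0 : S !=set0 by exists xs.
have c3p : 0 < 2 * (C2 + 1) by rewrite mulr_gt0// ltr_wpDl.
have C21_ge0 : 0 <= C2 + 1 by rewrite addr_ge0.
have C5_ge0 : 0 <= C3.
  repeat (apply: addr_ge0 => //); repeat (apply: mulr_ge0 => //);
    by rewrite ?sqr_ge0 ?powR_ge0.
(* The three bounds put [z] in the ball, make [M a <= 1], and keep the step below [delta / 2] so
   that [x'] stays in the ball. *)
pose eta := Num.min (delta / 4) (Num.min (M^-1 / 2) (delta / 2 / (2 * (C2 + 1)))).
(* The factors 2 come from [a <= 2 dist], the division by [omega] from (A3); [C3 + 1] ensures
   positivity. *)
exists eta, (2 * (C2 + 1)), ((C3 + 1) * powR 2 (1 + r) / omega); split => //.
- by rewrite !lt_min !divr_gt0// invr_gt0.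
- by rewrite divr_gt0// mulr_gt0// ?powR_gt0// ltr_wpDl.
move=> x x' bx; rewrite !le_min => /and3P[d1 d2 d3] [step stop].
have bx' : ball x by apply: (le_trans bx); have := delta_gt0; lra.
have d_ge0 := setdist_ge0 x S.
(* At distance zero [lam] vanishes and the linear system may be singular; the stopping clause gives
   [x' = x]. *)
have [d0|dn0] := eqVneq (setdist x S) 0.
  rewrite (stop (setdist0_gradient bx d0)) enorm0 d0 mulr0; split => //.
  have /eqP := stop (setdist0_gradient bx d0); rewrite subr_eq0 => /eqP ->.
  by rewrite d0 mulr_ge0 ?powR_ge0// divr_ge0// mulr_ge0 ?powR_ge0// addr_ge0.
have dp : 0 < setdist x S by rewrite lt_def dn0.
have [z Sz] := setdist_adherent x S0 dp => /ltW xz.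
have a_dist : enorm (x - z) <= 2 * setdist x S by lra.
have bz : ball z.
  rewrite /cball /=; apply: (le_trans (enorm_dist_trans x _ _)).
  by move: bx; rewrite /cball /= (enorm_distC z x); lra.
have a1 : enorm (x - z) <= 1 by have := delta_lt1; lra.
have Ma1 : M * enorm (x - z) <= 1.
  by rewrite mulrC -ler_pdivlMr// div1r; lra.
have a_gt0 : 0 < enorm (x - z).
  by apply: lt_le_trans dp _; exact: setdist_le.
have c3d : 2 * (C2 + 1) * setdist x S <= delta / 2.
  by rewrite mulrC -ler_pdivlMr.
have dle : enorm (x' - x) <= 2 * (C2 + 1) * setdist x S.
  apply: (le_trans (lm_step_le bx' Sz bz a_gt0 a1 a_dist Ma1 step)).
  by rewrite (mulrC 2) -mulrA ler_wpM2l// addr_ge0.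
split=> //.
have bx'' : ball (x + (x' - x)).
  rewrite addrC subrK /cball /=; apply: (le_trans (enorm_dist_trans x _ _)).
  by move: bx; rewrite /cball /=; lra.
have := lm_step_gradient bx' Sz bz a_gt0 a1 a_dist Ma1 step bx''.
rewrite [x + (x' - x)]addrC subrK in bx'' * => Gle.
rewrite mulrAC ler_pdivlMr// mulrC; apply: (le_trans (A3 bx'')).
apply: (le_trans Gle); rewrite -mulrA -powRM//.
apply: ler_pM; rewrite ?powR_ge0 ?lerDl//.
by apply: ge0_ler_powR; rewrite ?nnegrE ?enorm_ge0 ?mulr_ge0.
Qed.

End LMMSSStep.

(** * Convergence from a one-step estimate *)

(** Each coordinate is a telescoping series dominated by a geometric one, and the coordinate limits
    are assembled into [xbar]. *)
Lemma enorm_cvg_geometric (R : realType) n (x : nat -> 'cV[R]_n) (c q : R) :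
  `|q| < 1 -> (forall k, enorm (x k.+1 - x k) <= c * q ^+ k) ->
  exists xbar, (fun k => enorm (x k - xbar)) @ \oo --> (0 : R).
Proof.
move=> q1 xc.
have cvx i : cvgn (fun k => x k i 0).
  have ser : cvgn (series (telescope (fun k => x k i 0))).
    apply: normed_cvg.
    apply: (@series_le_cvg _ _ (geometric c q)) => [k|k|k|].
    - exact: normr_ge0.
    - by apply: le_trans (xc k); exact: enorm_ge0.
    - rewrite /telescope; apply: le_trans (xc k).
      by have := normr_coord_le (x k.+1 - x k) i; rewrite !mxE.
    - exact: is_cvg_geometric_series.
  rewrite (_ : (fun k => x k i 0) =
    (fun k => x 0%N i 0 + series (telescope (fun k => x k i 0)) k)); last first.
    by apply/funext => k; rewrite -eq_sum_telescope.
  by apply: is_cvgD => //; exact: is_cvg_cst.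
pose xbar := \col_i lim ((fun k => x k i 0) @ \oo).
exists xbar.
have sum0 : (fun k => \sum_i `|(x k - xbar) i 0|) @ \oo --> (0 : R).
  rewrite [X in _ --> X](_ : 0 = \sum_(i < n) (0 : R)); last by rewrite big1.
  apply: cvg_big => [|i _]; first exact: add_continuous.
  under eq_cvg do rewrite !mxE.
  apply/norm_cvg0P; apply/subr_cvg0.
  exact: cvx.
apply: (squeeze_cvgr _ (cvg_cst 0) sum0).
by apply: nearW => k; rewrite enorm_ge0 enorm_le_sum.
Qed.

(** Once [c4 dist^r <= 1/2] the distance halves at each step, so the step lengths are dominated by a
    geometric sequence and the iterates cannot leave the ball. [T] abstracts the method to its
    one-step estimate. *)
Lemma superlinear_of_step (R : realType) n (S : set 'cV[R]_n) (xs : 'cV[R]_n)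
  (T : 'cV[R]_n -> 'cV[R]_n -> Prop) (b eta c3 c4 r : R) :
  S xs -> 0 < b -> 0 < eta -> 0 < c3 -> 0 < c4 -> 0 < r ->
  (forall x x', cball xs b x -> setdist x S <= eta -> T x x' ->
     enorm (x' - x) <= c3 * setdist x S /\
     setdist x' S <= c4 * powR (setdist x S) (1 + r)) ->
  exists eps : R, 0 < eps /\ forall x : nat -> 'cV[R]_n,
    cball xs eps (x 0%N) -> (forall k, T (x k) (x k.+1)) ->
    superlinear_to0 (fun k => setdist (x k) S) /\
    exists xbar, [/\ setdist xbar S = 0, cball xs b xbar &
      (fun k => enorm (x k - xbar)) @ \oo --> (0 : R)].
Proof.
move=> Sxs b0 eta0 c30 c40 r0 Tstep.
have S0 : S !=set0 by exists xs.
(* The threshold is the solution [t] of [c4 t^r = e]. *)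
have small e t : 0 < e -> 0 <= t -> t <= powR (e / c4) r^-1 -> c4 * powR t r <= e.
  move=> e0 t0 te; rewrite mulrC -ler_pdivlMr//.
  rewrite -[leRHS]powRr1 ?(divr_ge0 (ltW e0) (ltW c40))// -(mulVf (lt0r_neq0 r0)) powRrM.
  by apply: ge0_ler_powR; rewrite ?nnegrE ?powR_ge0 ?(ltW r0).
(* The bounds allow the one-step estimate, force halving, and leave room for the total path length
   [2 c3 eps]. *)
pose eps := Num.min eta (Num.min (powR (2^-1 / c4) r^-1) (b / (1 + 2 * c3))).
have k0 : 0 < 1 + 2 * c3 by rewrite addr_gt0// mulr_gt0.
have eps0 : 0 < eps.
  by rewrite !lt_min eta0 powR_gt0 ?divr_gt0 ?invr_gt0.
have eps_eta : eps <= eta by rewrite ge_min lexx.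
have eps_r : eps <= powR (2^-1 / c4) r^-1 by rewrite !ge_min lexx orbT.
have eps_b : eps * (1 + 2 * c3) <= b.
  by rewrite -ler_pdivlMr// !ge_min lexx !orbT.
exists eps; split => // x bx0 Tx.
have half_ge0 k : 0 <= (2^-1 : R) ^+ k by rewrite exprn_ge0.
have half_le1 k : (2^-1 : R) ^+ k <= 1.
  by rewrite exprn_ile1// invf_le1// ler1n.
(* [2 c3 eps (1 - 2^-k)] is the sum of the first [k] step bounds [c3 eps 2^-j]. *)
have inv k : enorm (x k - xs) <= eps + 2 * c3 * eps * (1 - 2^-1 ^+ k) /\
    setdist (x k) S <= eps * 2^-1 ^+ k.
  elim: k => [|k [IHb IHd]].
    rewrite expr0 subrr mulr0 addr0 mulr1; split => //.
    by apply: le_trans (setdist_le _ Sxs) _.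
  have d_ge0 := setdist_ge0 (x k) S.
  have deps : setdist (x k) S <= eps by rewrite (le_trans IHd)// ler_piMr// ltW.
  have bx : cball xs b (x k).
    apply: (le_trans IHb); apply: le_trans eps_b.
    have : 2 * c3 * eps * (1 - 2^-1 ^+ k) <= 2 * c3 * eps.
      by rewrite ler_piMr ?mulr_ge0 ?ltW ?gerBl.
    by lra.
  have [st ds] := Tstep _ _ bx (le_trans deps eps_eta) (Tx k).
  split.
    apply: (le_trans (enorm_dist_trans (x k) _ _)).
    have := ler_wpM2l (ltW c30) IHd; rewrite exprS; lra.
  apply: (le_trans ds); rewrite powR_1D// mulrCA exprS.
  have := ler_wpM2l d_ge0 (small 2^-1 _ _ d_ge0 (le_trans deps eps_r)).
  by rewrite invr_gt0 ltr0n => /(_ isT); lra.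
have bx k : cball xs b (x k).
  apply: (le_trans (inv k).1); apply: le_trans eps_b.
  have : 2 * c3 * eps * (1 - 2^-1 ^+ k) <= 2 * c3 * eps.
    by rewrite ler_piMr ?mulr_ge0 ?ltW ?gerBl.
  by lra.
have dk k : setdist (x k) S <= eta.
  by rewrite (le_trans (inv k).2)// (le_trans _ eps_eta)// ler_piMr// ltW.
have half1 : `|2^-1 : R| < 1.
  by rewrite ger0_norm// invf_lt1// ltr1n.
have dcvg : (fun k => setdist (x k) S) @ \oo --> (0 : R).
  apply: (squeeze_cvgr _ (cvg_cst 0) (cvg_geometric eps half1)).
  by apply: nearW => k; rewrite setdist_ge0 (inv k).2.
split.
  split => // e e0.
  have pe : 0 < powR (e / c4) r^-1 by rewrite powR_gt0// divr_gt0.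
  near=> k.
  have d_ge0 := setdist_ge0 (x k) S.
  have [_ ds] := Tstep _ _ (bx k) (dk k) (Tx k).
  apply: (le_trans ds); rewrite powR_1D// mulrCA mulrC ler_wpM2r//.
  apply: small => //; near: k.
  exact: (cvgr_le _ dcvg).
have [xbar xcvg] : exists xbar, (fun k => enorm (x k - xbar)) @ \oo --> (0 : R).
  apply: (enorm_cvg_geometric (c := c3 * eps) half1) => k.
  have [st _] := Tstep _ _ (bx k) (dk k) (Tx k).
  by apply: (le_trans st); rewrite -mulrA ler_wpM2l ?(ltW c30)// (inv k).2.
exists xbar; split => //.
  (* The distance from [xbar] is at most [|x k - xbar| + dist (x k)], which tends to zero. *)
  apply/eqP; rewrite eq_le setdist_ge0 andbT.
  have sum0 : (fun k => enorm (x k - xbar) + setdist (x k) S) @ \oo --> (0 : R).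
    by rewrite -[X in _ --> X]addr0; exact: cvgD.
  apply: (cvgr_to_ge sum0); apply: nearW => k /=.
  by rewrite enorm_distC setdist_triangle.
rewrite /cball /=.
have sumb : (fun k => enorm (x k - xbar) + b) @ \oo --> b.
  by rewrite -[X in _ --> X]add0r; apply: cvgD => //; exact: cvg_cst.
apply: (cvgr_to_ge sumb); apply: nearW => k /=.
apply: (le_trans (enorm_dist_trans (x k) _ _)).
by rewrite (enorm_distC xbar) lerD2l; exact: bx.
Unshelve. all: by end_near. Qed.

(** * Combination of the one-step estimate with the convergence criterion *)

Unset Implicit Arguments.

Theorem mainTheorem10 (R : realType) (n m p : nat)
  (F : 'cV[R]_n -> 'cV[R]_m) (J : 'cV[R]_n -> 'M[R]_(m, n))
  (L : 'M[R]_(p, n)) (xs : 'cV[R]_n) (Omega : set 'cV[R]_n)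
  (gamma delta L0 omega r C : R) :
  (* F is C^2 with Jacobian J *)
  (forall x, differentiable F x /\ forall v, 'd F x v = J x *m v) ->
  (forall x, differentiable J x) ->
  (forall v, continuous (fun x => 'd J x v)) ->
  (m >= n)%N ->
  (p <= n)%N -> \rank L = p ->
  xs \in Xstar F J ->
  (* (A1) with Omega containing B(x*, delta) *)
  cball xs delta `<=` Omega ->
  0 < gamma ->
  (forall x, Omega x -> forall v : 'cV[R]_n,
      enorm (J x *m v) ^+ 2 + enorm (L *m v) ^+ 2 >= gamma * enorm v ^+ 2) ->
  (* (A2) *)
  0 < delta < 1 -> 0 < L0 ->
  (forall x y, cball xs delta x -> cball xs delta y ->
      specnorm (J x - J y) <= L0 * enorm (x - y)) ->
  (* (A3) *)
  0 < omega ->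
  (forall x, cball xs delta x ->
      omega * setdist x (Xstar F J) <= enorm ((J x)^T *m F x)) ->
  (* (A4) *)
  0 < r <= 1 -> 0 <= C ->
  (forall x z, cball xs delta x -> Xstar F J z -> cball xs delta z ->
      enorm ((J x - J z)^T *m F z) <= C * powR (enorm (x - z)) (1 + r)) ->
  exists eps : R, 0 < eps /\
    forall x : nat -> 'cV[R]_n,
      cball xs eps (x 0%N) ->
      LMMSS_seq F J L r x ->
      superlinear_to0 (fun k => setdist (x k) (Xstar F J)) /\
      exists xbar, Xstar F J xbar /\ cball xs (delta / 2) xbar /\
        (fun k => enorm (x k - xbar)) @ \oo --> (0 : R).
Proof.
move=> dF _ _ _ _ _ /set_mem Xxs sub gamma0 A1 delta01 L00 A2 omega0 A3 r01 C0 A4.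
have A1' x : cball xs delta x -> forall v : 'cV[R]_n,
  enorm (J x *m v) ^+ 2 + enorm (L *m v) ^+ 2 >= gamma * enorm v ^+ 2.
  by move=> /sub; exact: A1.
have [eta [c3 [c4 [eta0 c30 c40 step]]]] :=
  lmmss_step_superlinear (L := L) dF Xxs gamma0 A1' delta01 L00 A2 omega0 A3
    r01 C0 A4.
have /andP[delta0 delta1] := delta01; have /andP[r0 r1] := r01.
have delta20 : 0 < delta / 2 by rewrite divr_gt0.
have [eps [eps0 H]] := superlinear_of_step Xxs delta20 eta0
  c30 c40 r0 step.
exists eps; split => // x bx0 xseq.
have [sl [xbar [d0 bxbar xcvg]]] := H x bx0 xseq.
split => //; exists xbar; split => //.
(* Zero distance of the limit is upgraded to membership in [Xstar F J]. *)
exact: (setdist0_gradient dF Xxs delta01 L00 A2 r01 C0 A4).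
Qed.
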